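(* Of the functions $\{\mathbf{x}_\pi\}_{\pi\vdash[n],n\ge1}$ in $\mathrm{NCSym}$ and their scalar multiples, only $\pm\mathbf{x}_\pi$ where $\pi=B_1/B_2/\cdots/B_{\ell(\pi)}$ with $|B_i|\in\{1,2\}$ for $1\le i\le\ell(\pi)$ can be realized as $Y_G$ for some graph $G$. That is, if $\pi=B_1/\cdots/B_{\ell(\pi)}\vdash[n]$ with $n\ge1$, $c\in\mathbb{Q}$ and $c\,\mathbf{x}_\pi=Y_G$ for some labelled graph $G$, then $c\in\{1,-1\}$ and $|B_i|\in\{1,2\}$ for all $i$; and in particular, for every $\pi=B_1/\cdots/B_{\ell(\pi)}\vdash[n]$ with all $|B_i|\in\{1,2\}$, $$\mathbf{x}_\pi=(-1)^{t_\pi}\,Y_{K_\pi},$$ where $t_\pi$ is the number of indices $1\le i\le\ell(\pi)$ with $|B_i|=2$.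
   Context: All graphs are finite, simple and labelled: a graph $G$ with $n$ vertices has its vertices labelled bijectively by $[n]=\{1,\dots,n\}$; write $v_i$ for the vertex labelled $i$. Let $x_1,x_2,\dots$ be noncommuting variables. A proper colouring of $G$ is a map $\kappa$ from the vertices to $\{1,2,\dots\}$ with $\kappa(u)\ne\kappa(v)$ whenever $u,v$ are adjacent. $Y_G=\sum_\kappa x_{\kappa(v_1)}\cdots x_{\kappa(v_n)}\in\mathbb{Q}\langle\langle x_1,x_2,\dots\rangle\rangle$, summed over all proper colourings $\kappa$ of $G$. A set partition $\pi=B_1/\cdots/B_{\ell(\pi)}\vdash[n]$ is a family of disjoint nonempty sets (blocks) with union $[n]$. Set partitions of $[n]$ are ordered by refinement ($\pi\le\sigma$ iff every block of $\pi$ is contained in a block of $\sigma$), giving the partition lattice $\Pi_n$ with Möbius function $\mu_\Pi$. The graph $K_\pi$ is the disjoint union of complete graphs $K_{|B_1|}\cup\cdots\cup K_{|B_{\ell(\pi)}|}$, where the vertices of $K_{|B_i|}$ are labelled by the elements of $B_i$. For $\pi\vdash[n]$, $p_\pi=\sum x_{i_1}\cdots x_{i_n}$ over all tuples of positive integers with $i_j=i_k$ whenever $j,k$ are in the same block of $\pi$, and $\mathbf{x}_\pi=\sum_{\sigma\le\pi}\mu_\Pi(\sigma,\pi)\,p_\sigma$ (equivalently $p_\pi=\sum_{\sigma\le\pi}\mathbf{x}_\sigma$). $\mathrm{NCSym}\subset\mathbb{Q}\langle\langle x_1,x_2,\dots\rangle\rangle$ is the algebra spanned by $1$ and all $p_\pi$;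 the $\mathbf{x}_\pi$, $\pi\vdash[n]$, form a basis of its degree-$n$ part for each $n\ge1$. *)

(* Defs.v *)
From HB Require Import structures.
From mathcomp Require Import all_boot all_order all_algebra.
From mathcomp Require Import boolp classical_sets functions cardinality fsbigop.

Set Implicit Arguments.
Unset Strict Implicit.
Unset Printing Implicit Defensive.

Import Order.TTheory GRing.Theory Num.Theory.
Local Open Scope ring_scope.

(* Throughout, [n] = {1, ..., n} is represented by 'I_n, and the letters
   x_1, x_2, ... (like the colours 1, 2, ...) are indexed from 0 by nat. *)

(* A noncommutative formal power series over Q is its coefficient function on
   words; addition and scaling of series are the pointwise ones, for which the
   codomain is rat seen as a module over itself. *)
Notation ncseries := (seq nat -> rat^o).

(* The formal sum of the monomials [m i] for i in [A]; it is well defined when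
   each word arises from finitely many i.  (A finitely supported sum [\sum_(i
   \in A)] over an infinite support is 0 by convention; this never happens
   below, see [finite_wordP].) *)
Definition monomial_sum (I : choiceType) (A : set I) (m : I -> seq nat) :
    ncseries :=
  fun w => \sum_(i \in A) ((m i == w)%:R : rat).

Definition word n (f : {ffun 'I_n -> nat}) : seq nat := [seq f i | i <- enum 'I_n].

Lemma word_inj n : injective (@word n).
Proof.
move=> f g /eq_in_map fg; apply/ffunP => i.
by apply: fg; rewrite mem_enum.
Qed.

Lemma finite_wordP n (A : set {ffun 'I_n -> nat}) (w : seq nat) :
  finite_set (A `&` [set f | word f = w])%classic.
Proof.
have [[f fw]|nf] := pselect (exists f : {ffun 'I_n -> nat}, word f = w).
  apply: (@sub_finite_set _ _ [set f]%classic); last exact: finite_set1.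
  by move=> g [_ /= gw]; apply: word_inj; rewrite gw fw.
apply: (@sub_finite_set _ _ set0); last exact: finite_set0.
by move=> g [_ /= gw]; apply: nf; exists g.
Qed.

Record lgraph (n : nat) := LGraph {
  adj :> rel 'I_n;
  adj_sym : symmetric adj;
  adj_irr : irreflexive adj }.

Definition proper_colouring n (G : lgraph n) (kappa : {ffun 'I_n -> nat}) : Prop :=
  forall u v, G u v -> kappa u <> kappa v.

Definition Y n (G : lgraph n) : ncseries :=
  monomial_sum [set kappa | proper_colouring G kappa]%classic (@word n).

Section Mobius.
Context {disp : Order.disp_t} {T : finPOrderType disp}.
Implicit Types x y z : T.

(* mu(x, x) = 1, mu(x, y) = - \sum_(x <= z < y) mu(x, z) if x < y, and
   mu(x, y) = 0 otherwise; the recursion runs on a fuel bounding the length of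
   chains (see [mobiusxx], [mobius_lt] and [mobius_nle]). *)
Fixpoint mobius_fuel (k : nat) x y : int :=
  if k is k'.+1 then
    if x == y then 1
    else if (x < y)%O then - \sum_(z : T | (x <= z < y)%O) mobius_fuel k' x z
    else 0
  else 0.

Definition mobius x y : int := mobius_fuel #|T| x y.

Let rk y := #|[pred z | (z < y)%O]|.

Let rk_lt y z : (z < y)%O -> (rk z < rk y)%N.
Proof.
move=> zy; apply: proper_card; apply/properP; split.
  by apply/fintype.subsetP => t; rewrite !inE => /lt_trans; apply.
by exists z; rewrite !inE ?ltxx.
Qed.

Let rk_max y : (rk y < #|T|)%N.
Proof.
apply: proper_card; apply/properP; split; first by apply/fintype.subsetP.
by exists y; rewrite ?inE ?ltxx.
Qed.

Let mobius_fuelE k k' x y : (rk y < k)%N -> (rk y < k')%N ->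
  mobius_fuel k x y = mobius_fuel k' x y.
Proof.
elim: k k' y => [|k IH] [|k'] y //= yk yk'.
case: ifP => // _; case: ifP => // _; congr (- _).
apply: eq_bigr => z /andP[_ /rk_lt zy].
by apply: IH; apply: (leq_trans zy).
Qed.

Lemma mobiusxx x : mobius x x = 1.
Proof.
by rewrite /mobius; case: #|T| (rk_max x) => //= k _; rewrite eqxx.
Qed.

Lemma mobius_lt x y : (x < y)%O ->
  mobius x y = - \sum_(z : T | (x <= z < y)%O) mobius x z.
Proof.
move=> xy; rewrite [LHS](@mobius_fuelE _ #|T|.+1) ?leqW ?rk_max //=.
by rewrite (lt_eqF xy) xy.
Qed.

Lemma mobius_nle x y : ~~ (x <= y)%O -> mobius x y = 0.
Proof.
rewrite le_eqVlt negb_or => /andP[/negPf xy /negPf nxy].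
by rewrite /mobius; case: #|T| => //= k; rewrite xy nxy.
Qed.

End Mobius.

Record setpart (n : nat) := SetPart {
  blocks :> {set {set 'I_n}};
  blocksP : finset.partition blocks [set: 'I_n] }.

HB.instance Definition _ n := [isSub for @blocks n].
HB.instance Definition _ n := [Finite of setpart n by <:].

Definition refines n (pi sigma : setpart n) : bool :=
  [forall B in blocks pi, exists C in blocks sigma, B \subset C].

Lemma refines_refl n : reflexive (@refines n).
Proof.
by move=> pi; apply/forall_inP => B Bpi; apply/exists_inP; exists B.
Qed.

Lemma refines_trans n : transitive (@refines n).
Proof.
move=> s p t /forall_inP ps /forall_inP st; apply/forall_inP => B Bp.
have /exists_inP[C Cs BC] := ps _ Bp; have /exists_inP[D Dt CD] := st _ Cs.
by apply/exists_inP; exists D => //; apply: fintype.subset_trans CD.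
Qed.

Lemma refines_anti n : antisymmetric (@refines n).
Proof.
have sub (p s : setpart n) : refines p s -> refines s p -> blocks p \subset blocks s.
  move=> /forall_inP ps /forall_inP sp; apply/fintype.subsetP => B Bp.
  have /exists_inP[C Cs BC] := ps _ Bp; have /exists_inP[D Dp CD] := sp _ Cs.
  have /and3P[_ /finset.trivIsetP tI p0] := blocksP p.
  have BD : B = D.
    apply/eqP; apply: contraNT p0 => /(tI _ _ Bp Dp).
    rewrite -finset.setI_eq0 (finset.setIidPl (fintype.subset_trans BC CD)) => /eqP B0.
    by rewrite -B0.
  suff -> : B = C by [].
  by apply/eqP; rewrite finset.eqEsubset BC BD CD.
by move=> p s /andP[ps sp]; apply/val_inj/eqP; rewrite finset.eqEsubset !sub.
Qed.

Fact refinement_display : Order.disp_t. Proof. exact: Order.Disp tt tt. Qed.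

HB.instance Definition _ n :=
  Order.Le_isPOrder.Build refinement_display (setpart n)
    (@refines_refl n) (@refines_anti n) (@refines_trans n).

Definition same_block n (pi : setpart n) (i j : 'I_n) : bool :=
  [exists B in blocks pi, (i \in B) && (j \in B)].

Definition p_ n (pi : setpart n) : ncseries :=
  monomial_sum
    [set f : {ffun 'I_n -> nat} | forall j k, same_block pi j k -> f j = f k]%classic
    (@word n).

Definition x_ n (pi : setpart n) : ncseries :=
  \sum_(sigma : setpart n | (sigma <= pi)%O) (mobius sigma pi)%:~R *: p_ sigma.

Lemma K_sym n (pi : setpart n) :
  symmetric [rel i j | (i != j) && same_block pi i j].
Proof.
move=> i j /=; rewrite eq_sym; congr (_ && _).
by apply: eq_existsb => B; rewrite (andbC (i \in B)).
Qed.

Lemma K_irr n (pi : setpart n) :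
  irreflexive [rel i j | (i != j) && same_block pi i j].
Proof. by move=> i /=; rewrite eqxx. Qed.

Definition K n (pi : setpart n) : lgraph n := LGraph (K_sym pi) (K_irr pi).

(* Main.v *)
Require Import Defs.
From mathcomp Require Import all_boot all_order all_algebra perm.
From mathcomp Require Import boolp classical_sets functions cardinality fsbigop.
Import GRing.Theory.
Local Open Scope ring_scope.

Set Implicit Arguments.
Unset Strict Implicit.
Unset Printing Implicit Defensive.

Import Order.TTheory Num.Theory.

(* The coefficient of x_pi at a word f is the sum of mu(sigma, pi) over the
   sigma below both pi and the kernel of f, while the coefficients of Y_G are 0
   or 1. Suppose c x_pi = Y_G. The injective words give c mu(0, pi) = 1, and a
   word whose only repetition is at two positions i, j of a block B of pi gives
   c (mu(0, pi) + mu(ij, pi)) = 0 or 1, where ij is the atom joining i and j.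
   By Weisner's theorem applied to pi with i split off, mu(0, pi) is minus the
   sum of the mu(ij, pi) for j in B \ {i}, and these are all equal by symmetry:
   mu(0, pi) = - (|B| - 1) mu(ij, pi). The two constraints force |B| = 2.
   If all blocks of pi have at most two elements, the same theorem pairs the
   sigma <= pi with equal images under splitting off i, with opposite Moebius
   values; so x_pi vanishes at the words constant on some block of size 2, and
   equals mu(0, pi) = (-1)^t at the others. *)

(** * Moebius functions of finite posets *)

Section MobiusTheory.
Context {disp : Order.disp_t} {T : finPOrderType disp}.
Implicit Types x y z s t u : T.

Lemma sum_mobius_l x y :
  \sum_(z | (x <= z <= y)%O) mobius x z = (x == y)%:R.
Proof.
have [->|xy] := eqVneq x y.
  by rewrite (big_pred1 y) ?mobiusxx // => z; rewrite -eq_le eq_sym.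
have [lexy|nxy] := boolP (x <= y)%O; last first.
  by apply: big_pred0 => z; apply: contraNF nxy => /andP[]; apply: le_trans.
rewrite (bigD1 y) /=; last by rewrite lexy lexx.
rewrite mobius_lt ?lt_neqAle ?xy // (eq_bigl (fun z => (x <= z < y)%O)) ?addNr //.
by move=> z; rewrite lt_neqAle -andbA [(z <= y)%O && _]andbC.
Qed.

(* The Moebius and zeta matrices are mutually inverse, and a one-sided inverse
   of a square matrix is two-sided. *)
Lemma sum_mobius_r x y :
  \sum_(z | (x <= z <= y)%O) mobius z y = (x == y)%:R.
Proof.
pose Mu := \matrix_(i < #|T|, j < #|T|) mobius (enum_val i) (enum_val j).
pose Ze : 'M[int]_#|T| :=
  \matrix_(i, j) (enum_val i <= enum_val j)%O%:R.
have MuZe : Mu *m Ze = 1%:M.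
  apply/matrixP => i j; rewrite !mxE -(inj_eq enum_val_inj) -sum_mobius_l.
  rewrite [RHS]big_mkcond (reindex _ (onW_bij _ (enum_val_bij T))) /=.
  apply: eq_bigr => k _; rewrite !mxE; case: ifP => [/andP[_ ->]|].
    by rewrite mulr1.
  case: (boolP (enum_val i <= enum_val k)%O) => [_ /= ->|nik _].
    by rewrite mulr0.
  by rewrite mobius_nle ?mul0r.
have /matrixP/(_ (enum_rank x) (enum_rank y)) := mulmx1C MuZe.
rewrite !mxE (inj_eq enum_rank_inj) => <-.
rewrite [LHS]big_mkcond (reindex _ (onW_bij _ (enum_val_bij T))) /=.
apply: eq_bigr => k _; rewrite !mxE !enum_rankK; case: ifP => [/andP[-> _]|].
  by rewrite mul1r.
case: (boolP (x <= enum_val k)%O) => [_ /= nky|_ _]; last by rewrite mul0r.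
by rewrite mobius_nle ?nky ?mulr0.
Qed.

(* The dual of Weisner's theorem; [m] plays the role of the meet with [t]. *)
Lemma sum_mobius_fibre (t y : T) (m : T -> T) : (t < y)%O ->
    (forall z, (z <= y)%O -> (m z <= t)%O) ->
    (forall u z, (u <= t)%O -> (z <= y)%O -> (u <= m z)%O = (u <= z)%O) ->
  forall s, \sum_(z | (z <= y)%O && (m z == s)) mobius z y = 0.
Proof.
move=> ty mt um s.
(* Downward induction on [s]: summing over all [z >= s] gives 0, and the terms
   of that sum with [m z > s] cancel by induction. *)
have [k] := ubnP #|[pred z | (s < z)%O]|; elim: k s => // k IH s ks.
have [st|nst] := boolP (s <= t)%O; last first.
  by apply: big_pred0 => z; apply: contraNF nst => /andP[/mt zt /eqP <-].
have : \sum_(z | (s <= z <= y)%O) mobius z y = 0.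
  by rewrite sum_mobius_r (lt_eqF (le_lt_trans st ty)).
(* Group by [r = m z]; as [s <= t], the condition [s <= z] amounts to [s <= m z]. The class [r = s]
   is the sum in question, the classes [r > s] vanish by induction, and the others are empty. *)
rewrite (partition_big m predT) //= (bigD1 s) //= [X in _ + X]big1 ?addr0.
  move=> e; rewrite -[RHS]e; apply: eq_bigl => z; case: (boolP (z <= y)%O) => [zy|_]; last by rewrite andbF.
  by case: eqP => [zs|]; rewrite ?andbF // -um // zs lexx.
move=> r rs; have [sr|nsr] := boolP (s < r)%O; last first.
  apply: big_pred0 => z; apply: contraNF nsr => /andP[/andP[sz zy] /eqP zr].
  by rewrite lt_neqAle eq_sym rs -zr um.
rewrite -[RHS](IH r); last first.
  rewrite -ltnS (leq_trans _ ks) // ltnS; apply: proper_card; apply/properP; split.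
    by apply/fintype.subsetP => z; rewrite !inE; apply: lt_trans.
  by exists r; rewrite !inE ?ltxx.
apply: eq_bigl => z; case: (boolP (z <= y)%O) => [zy|_]; last by rewrite andbF.
by case: eqP => [zr|]; rewrite ?andbF // -um // zr ltW.
Qed.

(** Induction on the number of elements below [y], reindexing the recursion for [mobius] along
    [phi]. *)
Lemma mobius_aut (phi : T -> T) : bijective phi ->
    (forall x y, (phi x <= phi y)%O = (x <= y)%O) ->
  forall x y, mobius (phi x) (phi y) = mobius x y.
Proof.
move=> bphi le_phi x y.
have lt_phi u v : (phi u < phi v)%O = (u < v)%O by rewrite !lt_leAnge !le_phi.
have [k] := ubnP #|[pred z | (z < y)%O]|; elim: k y => // k IH y yk.
have [->|xy] := eqVneq x y; first by rewrite !mobiusxx.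
have [lexy|nxy] := boolP (x <= y)%O; last by rewrite !mobius_nle ?le_phi.
have ltxy : (x < y)%O by rewrite lt_neqAle xy.
rewrite !mobius_lt ?lt_phi // (reindex phi) /=; last exact: onW_bij.
congr (- _); apply: eq_big => z; rewrite !le_phi lt_phi // => /andP[_ zy].
apply: IH; rewrite -ltnS (leq_trans _ yk) // ltnS; apply: proper_card.
apply/properP; split.
  by apply/fintype.subsetP => u; rewrite !inE => /lt_trans; apply.
by exists z; rewrite !inE ?ltxx.
Qed.

End MobiusTheory.

(** * Set partitions *)

Section SetPartitions.
Variable n : nat.
Implicit Types (pi sigma tau : setpart n) (i j k u v : 'I_n).

Lemma same_blockE pi i j : same_block pi i j = (j \in finset.pblock pi i).
Proof.
have /and3P[/eqP cov tI _] := blocksP pi.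
apply/exists_inP/idP => [[B Bpi /andP[iB jB]]|jpi].
  by rewrite (finset.def_pblock tI Bpi iB).
exists (finset.pblock pi i) => //; first by rewrite finset.pblock_mem ?cov ?finset.in_setT.
by rewrite jpi finset.mem_pblock cov finset.in_setT.
Qed.

Lemma same_block_eq pi i j :
  same_block pi i j = (finset.pblock pi i == finset.pblock pi j).
Proof.
have /and3P[/eqP cov tI _] := blocksP pi.
by rewrite same_blockE finset.eq_pblock ?cov ?finset.in_setT.
Qed.

Lemma same_block_refl pi i : same_block pi i i.
Proof. by rewrite same_block_eq. Qed.

Lemma same_block_sym pi i j : same_block pi i j = same_block pi j i.
Proof. by rewrite !same_block_eq eq_sym. Qed.

Lemma same_block_trans pi j i k :
  same_block pi i j -> same_block pi j k -> same_block pi i k.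
Proof. by rewrite !same_block_eq => /eqP ->. Qed.

Lemma block_same_block pi (B : {set 'I_n}) i j : B \in blocks pi -> i \in B ->
  same_block pi i j = (j \in B).
Proof.
have /and3P[_ tI _] := blocksP pi.
by move=> Bpi iB; rewrite same_blockE (finset.def_pblock tI Bpi iB).
Qed.

Lemma pblock_block pi i : finset.pblock pi i \in blocks pi.
Proof.
by have /and3P[/eqP cov _ _] := blocksP pi; rewrite finset.pblock_mem ?cov ?finset.in_setT.
Qed.

Lemma setpart_leP sigma pi :
  reflect (forall i j, same_block sigma i j -> same_block pi i j)
          (sigma <= pi)%O.
Proof.
apply: (iffP forall_inP) => [le_sp i j /exists_inP[B Bs /andP[iB jB]]|le_sp B Bs].
  have /exists_inP[C Cp /fintype.subsetP BC] := le_sp B Bs.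
  by apply/exists_inP; exists C; rewrite ?BC.
have /and3P[_ _ s0] := blocksP sigma.
have [B0|[i iB]] := finset.set_0Vmem B; first by rewrite -B0 Bs in s0.
apply/exists_inP; exists (finset.pblock pi i); first exact: pblock_block.
apply/fintype.subsetP => j jB; rewrite -same_blockE le_sp //.
by rewrite (block_same_block _ Bs).
Qed.

Lemma setpart_ext sigma pi : same_block sigma =2 same_block pi -> sigma = pi.
Proof.
by move=> e; apply/le_anti/andP; split; apply/setpart_leP => i j; rewrite e.
Qed.

(** * Kernels, splitting off a point, and atoms *)

Definition ker_part (T : eqType) (f : 'I_n -> T) : setpart n :=
  SetPart (finset.preim_partitionP f [set: 'I_n]).

Lemma same_block_ker (T : eqType) (f : 'I_n -> T) i j :
  same_block (ker_part f) i j = (f i == f j).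
Proof.
rewrite same_blockE /= finset.pblock_equivalence_partition ?finset.in_setT //.
by split=> // /eqP ->.
Qed.

Lemma le_kerP (T : eqType) (f : 'I_n -> T) sigma :
  reflect (forall i j, same_block sigma i j -> f i = f j)
          (sigma <= ker_part f)%O.
Proof.
apply: (iffP (setpart_leP _ _)) => fs i j /fs; rewrite same_block_ker => /eqP //.
Qed.

Definition discrete : setpart n := ker_part (@id 'I_n).

(** The meet of [pi] with the partition separating [i] from all other points: the label [None]
    belongs to [i] alone, and the other blocks at most lose [i]. *)
Definition isolate i pi : setpart n :=
  ker_part (fun k => if k == i then None else Some (finset.pblock pi k)).

Definition atom i j : setpart n := ker_part (fun k => if k == j then i else k).

Lemma same_block_discrete i j : same_block discrete i j = (i == j).
Proof. exact: same_block_ker. Qed.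

Lemma discrete_le pi : (discrete <= pi)%O.
Proof.
by apply/setpart_leP => i j; rewrite same_block_discrete => /eqP ->; apply: same_block_refl.
Qed.

Lemma same_block_isolate i pi u v : same_block (isolate i pi) u v =
  (u == v) || [&& u != i, v != i & same_block pi u v].
Proof.
rewrite same_block_ker same_block_eq; have [->|uv] := eqVneq u v; first by rewrite eqxx.
case: (eqVneq u i) => [ui|ui]; case: (eqVneq v i) => [vi|vi] //=.
by rewrite ui vi eqxx in uv.
Qed.

Lemma same_block_atom i j u v : same_block (atom i j) u v =
  [|| u == v, (u == i) && (v == j) | (u == j) && (v == i)].
Proof.
rewrite same_block_ker (eq_sym v i).
case: (eqVneq u j) => [->|uj]; case: (eqVneq v j) => [->|vj];
  rewrite ?eqxx ?andbT ?andbF ?orbF //=.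
by rewrite (negPf uj).
Qed.

Lemma isolate_le i pi : (isolate i pi <= pi)%O.
Proof.
apply/setpart_leP => u v; rewrite same_block_isolate => /orP[/eqP ->|/and3P[] //].
exact: same_block_refl.
Qed.

Lemma isolate_lt i j pi : i != j -> same_block pi i j -> (isolate i pi < pi)%O.
Proof.
move=> ij pij; rewrite lt_neqAle isolate_le andbT; apply/eqP => e.
by move: pij; rewrite -e same_block_isolate eqxx (negPf ij).
Qed.

Lemma isolate_homo i sigma pi :
  (sigma <= pi)%O -> (isolate i sigma <= isolate i pi)%O.
Proof.
move=> /setpart_leP le_sp; apply/setpart_leP => u v; rewrite !same_block_isolate.
by case/orP=> [->//|/and3P[-> -> /le_sp ->]]; rewrite orbT.
Qed.

(** Below [isolate i pi] the point [i] is alone, so splitting it off from [sigma] costs nothing.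
    This is the meet property required by [sum_mobius_fibre]. *)
Lemma le_isolate i tau pi sigma : (tau <= isolate i pi)%O ->
  (tau <= isolate i sigma)%O = (tau <= sigma)%O.
Proof.
move=> /setpart_leP tp; apply/idP/idP => [/le_trans|/setpart_leP ts].
  by apply; apply: isolate_le.
apply/setpart_leP => u v uv; have := ts _ _ uv; have := tp _ _ uv.
by rewrite !same_block_isolate => /orP[->//|/and3P[-> -> _ ->]]; rewrite orbT.
Qed.

(** The dual Weisner theorem for [t = isolate i pi] and [m = isolate i]; the point [j] ensures that
    [t] is strictly below [pi]. *)
Lemma sum_mobius_isolate i j pi tau : i != j -> same_block pi i j ->
  \sum_(sigma | (sigma <= pi)%O && (isolate i sigma == tau)) mobius sigma pi = 0.
Proof.
move=> ij pij; apply: (sum_mobius_fibre (isolate_lt ij pij)) => [z|u z ut _].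
  exact: isolate_homo.
exact: le_isolate ut.
Qed.

(* The transposition of [j] and [k] induces an automorphism fixing [pi]. *)
Lemma mobius_atom i j k pi : i != j -> i != k ->
    same_block pi i j -> same_block pi i k ->
  mobius (atom i j) pi = mobius (atom i k) pi.
Proof.
move=> ij ik pij pik; pose g := tperm j k.
pose phi sigma := ker_part (fun u => finset.pblock sigma (g u)).
have phiE sigma u v : same_block (phi sigma) u v = same_block sigma (g u) (g v).
  by rewrite same_block_ker same_block_eq.
have phiK : involutive phi.
  by move=> sigma; apply: setpart_ext => u v; rewrite !phiE !tpermK.
have phi_homo sigma tau : (sigma <= tau)%O -> (phi sigma <= phi tau)%O.
  by move=> /setpart_leP st; apply/setpart_leP => u v; rewrite !phiE; apply: st.
have le_phi sigma tau : (phi sigma <= phi tau)%O = (sigma <= tau)%O.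
  by apply/idP/idP => /phi_homo //; rewrite !phiK.
rewrite -(mobius_aut (inv_bij phiK) le_phi).
(* It remains that [phi] maps [atom i j] to [atom i k] and fixes [pi]; the latter holds because [j]
   and [k] share a block of [pi]. *)
congr mobius; apply: setpart_ext => u v; rewrite phiE.
  rewrite !same_block_atom (inj_eq perm_inj).
  have gi w : (g w == i) = (w == i).
    by rewrite -{1}[i](tpermD (x := j) (y := k) (z := i)) 1?eq_sym // (inj_eq perm_inj).
  have gj w : (g w == j) = (w == k).
    by rewrite -{1}[j](tpermR j k) (inj_eq perm_inj).
  by rewrite !gi !gj.
have pg w : finset.pblock pi (g w) = finset.pblock pi w.
  move: pij pik; rewrite !same_block_eq => /eqP ej /eqP ek.
  by rewrite /g; case: tpermP => [->|->|//]; rewrite -ej -ek.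
by rewrite !same_block_eq !pg.
Qed.

Lemma atom_inj i : injective (atom i).
Proof.
move=> j k e.
have : same_block (atom i k) i j by rewrite -e same_block_atom !eqxx orbT.
have : same_block (atom i j) i k by rewrite e same_block_atom !eqxx orbT.
rewrite !same_block_atom eqxx /= (eq_sym k j) (eq_sym k i) (eq_sym j i).
case: (eqVneq j k) => // _; rewrite /= => /orP[/eqP <-|/andP[/eqP <- /eqP //]].
by case: (eqVneq i j); rewrite /= ?andbF.
Qed.

Lemma atom_neq_discrete i j : i != j -> atom i j != discrete.
Proof.
move=> ij; apply/eqP => e; have := same_block_atom i j i j.
by rewrite e same_block_discrete !eqxx (negPf ij).
Qed.

Lemma atom_le i j pi : (atom i j <= pi)%O = same_block pi i j.
Proof.
apply/setpart_leP/idP => [->//|pij u v]; first by rewrite same_block_atom !eqxx orbT.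
rewrite same_block_atom => /or3P[/eqP ->|/andP[/eqP -> /eqP ->]//|/andP[/eqP -> /eqP ->]].
  exact: same_block_refl.
by rewrite same_block_sym.
Qed.

Lemma le_atom i j sigma :
  (sigma <= atom i j)%O = (sigma == discrete) || (sigma == atom i j).
Proof.
apply/idP/orP=> [sa|[]/eqP ->]; rewrite ?discrete_le ?lexx //.
have [sij|nsij] := boolP (same_block sigma i j); [right|left]; apply/eqP.
  by apply/le_anti; rewrite sa atom_le.
apply/le_anti; rewrite discrete_le andbT; apply/setpart_leP => u v suv.
rewrite same_block_discrete; move/setpart_leP: sa => /(_ _ _ suv).
rewrite same_block_atom => /or3P[//|/andP[/eqP ui /eqP vj]|/andP[/eqP uj /eqP vi]].
  by rewrite -ui -vj suv in nsij.
by rewrite -uj -vi same_block_sym suv in nsij.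
Qed.

(** Away from [i] such a [sigma] is discrete, so at most one point is joined to [i]. This determines
    the fibre of [isolate i] over [discrete]. *)
Lemma isolate_discreteP i sigma :
  isolate i sigma = discrete -> sigma = discrete \/ exists2 j, i != j & sigma = atom i j.
Proof.
move=> e; have iso u v : u != i -> v != i -> same_block sigma u v -> u = v.
  move=> ui vi uv; apply/eqP; rewrite -same_block_discrete -e same_block_isolate.
  by rewrite ui vi uv orbT.
have [j /andP[ij sij]|none] := pickP (fun j => (i != j) && same_block sigma i j).
  right; exists j => //; apply/le_anti; rewrite atom_le sij andbT.
  apply/setpart_leP => u v suv; rewrite same_block_atom.
  have [->//|uv /=] := eqVneq u v.
  have [ui|ui] := eqVneq u i; rewrite /=.
    rewrite (iso v j) ?eqxx // 1?eq_sym //; first by rewrite -ui.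
    by apply: same_block_trans sij; rewrite same_block_sym -ui.
  have [vi|vi] := eqVneq v i; last by rewrite (iso u v) ?eqxx in uv.
  by rewrite (iso u j) ?eqxx // 1?eq_sym //; apply: same_block_trans sij; rewrite -vi.
left; apply: setpart_ext => u v; rewrite same_block_discrete.
apply/idP/eqP => [suv|->]; last exact: same_block_refl.
have [ui|ui] := eqVneq u i.
  by have := none v; rewrite -ui suv andbT => /negbFE /eqP.
have [vi|vi] := eqVneq v i; last exact: iso.
by have := none u; rewrite -vi same_block_sym suv andbT => /negbFE /eqP.
Qed.

(** Below [pi], the fibre of [isolate i] over [discrete] consists of [discrete] and the atoms
    joining [i] to another point of [B]. Its Moebius values sum to 0, and the atoms contribute
    equally by symmetry. *)
Lemma mobius_discrete_atom i j pi (B : {set 'I_n}) : B \in blocks pi ->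
    i \in B -> j \in B -> i != j ->
  mobius discrete pi = - (mobius (atom i j) pi *+ #|B|.-1).
Proof.
move=> Bpi iB jB ij; apply/eqP; rewrite -addr_eq0; apply/eqP.
have pij k : same_block pi i k = (k \in B) by rewrite (block_same_block _ Bpi).
have sij : same_block pi i j by rewrite pij.
rewrite -(sum_mobius_isolate discrete ij sij) (bigD1 discrete) /=; last first.
  rewrite discrete_le; apply/eqP/le_anti; rewrite discrete_le andbT.
  exact: isolate_le.
congr (_ + _); rewrite (eq_bigl (mem [set atom i k | k in B :\ i])); last first.
  move=> sigma; rewrite inE; apply/idP/imsetP => [/andP[/andP[sp /eqP iso] s0]|].
    have [s_eq|[k ik s_eq]] := isolate_discreteP iso; first by rewrite s_eq eqxx in s0.
    by exists k; rewrite // !inE eq_sym ik -pij -atom_le -s_eq.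
  case=> k; rewrite !inE eq_sym => /andP[ik kB] ->.
  rewrite atom_le pij kB atom_neq_discrete // andbT; apply/eqP/setpart_ext => u v.
  rewrite same_block_isolate same_block_discrete same_block_atom.
  by case: (eqVneq u v); case: (eqVneq u i); case: (eqVneq v i); rewrite /= ?andbF.
rewrite big_imset /=; last by move=> k l _ _; apply: atom_inj.
rewrite (eq_bigr (fun=> mobius (atom i j) pi)); last first.
  move=> k; rewrite !inE eq_sym => /andP[ik kB].
  by rewrite (mobius_atom (k := j) ik ij) // pij.
by rewrite sumr_const (cardsD1 i B) iB.
Qed.

(** * Partitions into blocks of size at most two *)

(* All blocks have at most two elements. *)
Definition thin pi : Prop := forall i j k, same_block pi i j ->
  same_block pi i k -> [|| i == j, i == k | j == k].

Lemma thinP pi :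
  (forall B : {set 'I_n}, B \in blocks pi -> #|B| = 1%N \/ #|B| = 2%N) -> thin pi.
Proof.
move=> small i j k; rewrite !same_blockE => ij ik; apply: contraT.
rewrite !negb_or => /and3P[nij nik njk].
have ii : i \in finset.pblock pi i by rewrite -same_blockE same_block_refl.
have : (#|i |: [set j; k]| <= #|finset.pblock pi i|)%N.
  by apply/subset_leq_card/fintype.subsetP => u; rewrite !inE => /or3P[]/eqP ->.
rewrite cardsU1 cards2 !inE negb_or nij nik njk.
by case: (small _ (pblock_block pi i)) => ->.
Qed.

Lemma thin_le sigma pi : (sigma <= pi)%O -> thin pi -> thin sigma.
Proof. by move=> /setpart_leP sp th i j k /sp ij /sp; apply: th. Qed.

Lemma thin_block2P pi (B : {set 'I_n}) : thin pi ->
  reflect (exists u v, [/\ u != v, same_block pi u v & B = [set u; v]%SET])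
          ((B \in blocks pi) && (#|B| == 2%N)).
Proof.
move=> th; apply: (iffP andP) => [[Bpi /cards2P[u [v [uv eB]]]]|[u [v [uv suv ->]]]].
  exists u, v; split=> //.
  by rewrite (block_same_block _ Bpi) eB !inE eqxx ?orbT.
rewrite cards2 uv; split=> //; suff -> : [set u; v]%SET = finset.pblock pi u.
  exact: pblock_block.
apply/finset.setP => w; rewrite -same_blockE !inE; apply/orP/idP.
  by case=> /eqP -> //; apply: same_block_refl.
by move=> /(th _ _ _ suv); rewrite (negPf uv) /= !(eq_sym _ w) => /orP.
Qed.

(** The block of [i] in [sigma] is [{i}] or [{i, j}]. Hence [sigma] is determined by
    [isolate i sigma] and by whether it joins [i] and [j], so fibres of [isolate i] have at most two
    elements. *)
Lemma thin_same_block i j pi sigma u v : thin pi -> (sigma <= pi)%O ->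
    i != j -> same_block pi i j ->
  same_block sigma u v = same_block (isolate i sigma) u v
    || same_block (atom i j) u v && same_block sigma i j.
Proof.
move=> th /setpart_leP sp ij pij; rewrite same_block_isolate same_block_atom.
have row w : same_block sigma i w = (i == w) || (w == j) && same_block sigma i j.
  have [<-|iw] := eqVneq i w; first by rewrite same_block_refl.
  have [->//|wj] := eqVneq w j; apply/negbTE/negP => /sp /(th _ _ _ pij).
  by rewrite (negPf ij) (negPf iw) eq_sym (negPf wj).
have [->|uv] := eqVneq u v; first by rewrite same_block_refl.
case: (eqVneq u i) uv => [->|ui] uv.
  by rewrite row (eq_sym v i) (negPf uv) ?andbF ?orbF.
case: (eqVneq v i) uv => [->|vi] uv; rewrite /= ?andbF ?orbF //.
by rewrite same_block_sym row (eq_sym i) (negPf uv) andbT.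
Qed.

(** Splitting off [i] breaks the block [{i, j}] into singletons and leaves the other blocks
    intact. *)
Lemma card_block2_isolate i j pi : thin pi -> i != j -> same_block pi i j ->
  #|[set B in blocks pi | #|B| == 2%N]%SET| =
  #|[set B in blocks (isolate i pi) | #|B| == 2%N]%SET|.+1.
Proof.
move=> th ij pij; have th' := thin_le (isolate_le i pi) th.
have ijn : [set i; j]%SET \notin [set B in blocks (isolate i pi) | #|B| == 2%N]%SET.
  rewrite inE; apply/(thin_block2P _ th') => -[u [v [uv iuv e]]].
  have : i \in [set u; v]%SET by rewrite -e !inE eqxx.
  move: iuv; rewrite same_block_isolate (negPf uv) /= !inE => /and3P[ui vi _].
  by rewrite !(eq_sym i) (negPf ui) (negPf vi).
transitivity #|[set i; j]%SET |: [set B in blocks (isolate i pi) | #|B| == 2%N]%SET|;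
  last by rewrite cardsU1 ijn.
apply: eq_card => B; rewrite inE finset.in_setU finset.in_set1 inE.
apply/(thin_block2P _ th)/orP => [[u [v [uv puv ->]]]|[/eqP ->|]].
- have [ui|ui] := eqVneq u i.
    left; rewrite ui in uv puv *; move: (th i j v pij puv).
    by rewrite (negPf ij) (negPf uv) => /eqP ->.
  have [vi|vi] := eqVneq v i.
    left; rewrite vi same_block_sym in uv puv *; move: (th i j u pij puv).
    by rewrite (negPf ij) eq_sym (negPf uv) => /eqP ->; rewrite finset.setUC.
  right; apply/(thin_block2P _ th'); exists u, v; split=> //.
  by rewrite same_block_isolate ui vi puv orbT.
- by exists i, j.
- move=> /(thin_block2P _ th')[u [v [uv iuv ->]]]; exists u, v; split=> //.
  by move/setpart_leP: (isolate_le i pi); apply.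
Qed.

(** The fibre through [sigma] is exactly [sigma] and [isolate i sigma], and its Moebius sum is 0. *)
Lemma mobius_isolate i j pi sigma : thin pi -> (sigma <= pi)%O -> i != j ->
  same_block sigma i j -> mobius (isolate i sigma) pi = - mobius sigma pi.
Proof.
move=> th sp ij sij; have pij : same_block pi i j by move/setpart_leP: (sp); apply.
apply/eqP; rewrite -addr_eq0; apply/eqP.
have isoK tau : isolate i (isolate i tau) = isolate i tau.
  apply: setpart_ext => u v; rewrite !same_block_isolate.
  by case: (u == v); case: (u == i); case: (v == i).
rewrite -(sum_mobius_isolate (isolate i sigma) ij pij) (bigD1 (isolate i sigma)) /=; last first.
  by rewrite isoK eqxx andbT; apply: le_trans sp; apply: isolate_le.
rewrite (bigD1 sigma) /=; last first.
  by rewrite sp eqxx; apply/eqP => e; have := isolate_lt ij sij; rewrite -e ltxx.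
rewrite big1 ?addr0 // => tau /andP[/andP[/andP[tp /eqP e] t_iso] t_s].
have [tij|ntij] := boolP (same_block tau i j).
  case/eqP: t_s; apply: setpart_ext => u v.
  rewrite (thin_same_block u v th tp ij pij) (thin_same_block u v th sp ij pij).
  by rewrite e tij sij.
case/eqP: t_iso; apply: setpart_ext => u v.
by rewrite (thin_same_block u v th tp ij pij) e (negPf ntij) andbF orbF.
Qed.

(** Each splitting of a block of size 2 flips the sign and lowers the number of such blocks by one,
    until [discrete] is reached. *)
Lemma mobius_thin pi sigma : thin pi -> (sigma <= pi)%O ->
  mobius sigma pi =
  (-1) ^+ #|[set B in blocks sigma | #|B| == 2%N]%SET| * mobius discrete pi.
Proof.
move=> th; have [k] := ubnP #|[set B in blocks sigma | #|B| == 2%N]%SET|.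
elim: k sigma => // k IH sigma ks sp.
have [[i j] /= /andP[ij sij]|none] :=
    pickP (fun p : 'I_n * 'I_n => (p.1 != p.2) && same_block sigma p.1 p.2).
  have e := card_block2_isolate (thin_le sp th) ij sij.
  rewrite e exprS mulN1r mulNr -IH ?(mobius_isolate th sp ij sij) ?opprK //.
    by rewrite e in ks.
  by apply: le_trans sp; apply: isolate_le.
have -> : sigma = discrete.
  apply: setpart_ext => u v; rewrite same_block_discrete.
  apply/idP/eqP => [suv|->]; last exact: same_block_refl.
  by have := none (u, v); rewrite /= suv andbT => /negbFE /eqP.
rewrite [#|_|](_ : _ = 0%N) ?mul1r //; apply: eq_card0 => B; rewrite inE.
apply/(thin_block2P _ (thin_le (discrete_le pi) th)) => -[u [v [uv]]].
by rewrite same_block_discrete (negPf uv).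
Qed.

(** The case [sigma = pi] of [mobius_thin], where the left side is 1; a sign is its own inverse. *)
Lemma mobius_discrete_thin pi : thin pi ->
  mobius discrete pi = (-1) ^+ #|[set B in blocks pi | #|B| == 2%N]%SET|.
Proof.
move=> th; have := mobius_thin th (lexx pi); rewrite mobiusxx => e.
by rewrite -[LHS]mul1r -[in LHS](signrMK #|[set B in blocks pi | #|B| == 2%N]%SET| 1)
   mulr1 -mulrA -e mulr1.
Qed.

(** * Coefficients of the series *)

Lemma monomial_sum_word (A : set {ffun 'I_n -> nat}) (f : {ffun 'I_n -> nat}) :
  monomial_sum A (@word n) (word f) = (`[< A f >])%:R.
Proof.
rewrite /monomial_sum; case: asboolP => [Af|nAf]; last first.
  by apply: fsbig1 => g Ag; case: eqP => // /word_inj gf; rewrite -gf in nAf.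
rewrite -(fsbig_widen [set f]%classic A) ?fsbig_set1 ?eqxx // => [g -> //|g [_ gf]].
by rewrite /preimage /=; case: eqP => [/word_inj|].
Qed.

Lemma monomial_sum_size (A : set {ffun 'I_n -> nat}) (w : seq nat) :
  size w != n -> monomial_sum A (@word n) w = 0.
Proof.
move=> wn; apply: fsbig1 => f _; case: eqP => // fw.
by rewrite -fw size_map size_enum_ord eqxx in wn.
Qed.

Lemma wordP (w : seq nat) :
  size w = n -> exists f : {ffun 'I_n -> nat}, w = word f.
Proof.
(* The default 0 of [nth] is never read, every index being smaller than [size w]. *)
move=> wn; exists [ffun i : 'I_n => nth 0%N w i].
rewrite /word (eq_map (g := nth 0%N w \o val)) => [|i]; last by rewrite ffunE.
by rewrite map_comp val_enum_ord -wn -/(mkseq _ _) mkseq_nth.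
Qed.

Lemma p_word pi (f : {ffun 'I_n -> nat}) :
  p_ pi (word f) = ((pi <= ker_part f)%O)%:R.
Proof.
rewrite /p_ monomial_sum_word; congr (nat_of_bool _)%:R.
by apply/asboolP/le_kerP.
Qed.

Lemma x_word pi (f : {ffun 'I_n -> nat}) : x_ pi (word f) =
  (\sum_(sigma | (sigma <= pi)%O && (sigma <= ker_part f)%O) mobius sigma pi)%:~R.
Proof.
rewrite /x_ fct_sumE rmorph_sum /= big_mkcondr /=; apply: eq_bigr => sigma _.
rewrite [LHS](_ : _ = (mobius sigma pi)%:~R * p_ sigma (word f)) // p_word.
by case: ifP; rewrite ?mulr1 ?mulr0.
Qed.

Lemma x_size pi (w : seq nat) : size w != n -> x_ pi w = 0.
Proof.
move=> wn; rewrite /x_ fct_sumE big1 // => sigma _.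
by rewrite [LHS](_ : _ = (mobius sigma pi)%:~R * p_ sigma w) // /p_ monomial_sum_size ?mulr0.
Qed.

(** As [f] is injective on each block of [pi], only [discrete] lies below both [pi] and the kernel
    of [f]. *)
Lemma x_word_discrete pi (f : {ffun 'I_n -> nat}) :
  (forall i j, same_block pi i j -> f i = f j -> i = j) ->
  x_ pi (word f) = (mobius discrete pi)%:~R.
Proof.
move=> inj_f; rewrite x_word (big_pred1 discrete) // => sigma /=.
apply/andP/eqP => [[/setpart_leP sp /le_kerP sf]|->]; last by rewrite !discrete_le.
apply: setpart_ext => u v; rewrite same_block_discrete.
by apply/idP/eqP => [suv|->]; [apply: inj_f; auto|apply: same_block_refl].
Qed.

(** Since [f i = f j], joining [i] and [j] does not affect lying below the kernel of [f]. So each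
    fibre of [isolate i] is summed entirely or not at all, and whole fibres sum to 0. *)
Lemma x_word_thin0 pi (f : {ffun 'I_n -> nat}) i j : thin pi ->
  i != j -> same_block pi i j -> f i = f j -> x_ pi (word f) = 0.
Proof.
move=> th ij pij fij; rewrite x_word (partition_big (isolate i) predT) //= big1 // => tau _.
have [tf|ntf] := boolP (tau <= ker_part f)%O.
  rewrite -[RHS](sum_mobius_isolate tau ij pij); apply: eq_bigl => sigma.
  case: (boolP (sigma <= pi)%O) => [sp|//]; case: eqP => [e|]; rewrite ?andbF // !andbT.
  apply/le_kerP => u v; rewrite (thin_same_block u v th sp ij pij) e.
  case/orP=> [|/andP[]]; first by move/le_kerP: tf; apply.
  by rewrite same_block_atom => /or3P[/eqP ->|/andP[/eqP -> /eqP ->]|/andP[/eqP -> /eqP ->]].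
apply: big_pred0 => sigma; apply: contraNF ntf => /andP[/andP[_ sf] /eqP <-].
by apply: le_trans sf; apply: isolate_le.
Qed.

Lemma x_word_atom pi i j : i != j -> same_block pi i j ->
  x_ pi (word [ffun k : 'I_n => val (if k == j then i else k)]) =
  (mobius discrete pi + mobius (atom i j) pi)%:~R.
Proof.
move=> ij pij; rewrite x_word; congr _%:~R.
have -> : ker_part [ffun k : 'I_n => val (if k == j then i else k)] = atom i j.
  by apply: setpart_ext => u v; rewrite !same_block_ker !ffunE (inj_eq val_inj).
rewrite (bigD1 discrete) ?discrete_le //=; congr (_ + _).
rewrite (big_pred1 (atom i j)) // => sigma /=; rewrite le_atom.
have [->|s0] := eqVneq sigma discrete.
  by rewrite andbF eq_sym (negPf (atom_neq_discrete ij)).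
by rewrite andbT; case: eqP => [->|]; rewrite ?andbF // atom_le pij.
Qed.

(** * Comparison with chromatic series *)

Lemma Y_word (G : lgraph n) (f : {ffun 'I_n -> nat}) :
  Y G (word f) = (`[< proper_colouring G f >])%:R.
Proof. exact: monomial_sum_word. Qed.

(** Pairwise distinct colours are proper for every graph; this coefficient normalises [c]. *)
Lemma Y_word_id (G : lgraph n) : Y G (word [ffun k : 'I_n => val k]) = 1.
Proof.
rewrite Y_word asboolT // => u v Guv; rewrite !ffunE => /val_inj uv.
by rewrite uv (adj_irr G) in Guv.
Qed.

Lemma x_thin pi : thin pi ->
  x_ pi = (-1) ^+ #|[set B in blocks pi | #|B| == 2%N]%SET| *: Y (K pi).
Proof.
move=> th; apply/funext => w.
rewrite [RHS](_ : _ = (-1) ^+ #|[set B in blocks pi | #|B| == 2%N]%SET| * Y (K pi) w) //.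
have [/wordP[f ->]|wn] := eqVneq (size w) n; last first.
  by rewrite x_size // /Y monomial_sum_size ?mulr0.
rewrite Y_word; case: asboolP => [pf|npf].
  rewrite mulr1 x_word_discrete ?mobius_discrete_thin ?rmorph_sign //.
  move=> i j pij fij; apply/eqP; apply: contraT => ij.
  by case: (pf i j) => //=; rewrite ij.
(* A colouring that is not proper repeats a colour at two points of one block, where the coefficient
   of [x_ pi] vanishes. *)
rewrite mulr0; have [[i j] /= /and3P[ij pij /eqP fij]|none] :=
  pickP (fun p : 'I_n * 'I_n => [&& p.1 != p.2, same_block pi p.1 p.2 & f p.1 == f p.2]).
  exact: x_word_thin0 fij.
case: npf => u v /= /andP[uv puv] fuv.
by have := none (u, v); rewrite /= uv puv fuv eqxx.
Qed.

Lemma card_block_of_scaled_Y pi (c : rat) (G : lgraph n) :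
  c *: x_ pi = Y G ->
  forall B : {set 'I_n}, B \in blocks pi -> #|B| = 1%N \/ #|B| = 2%N.
Proof.
move=> cxY B Bpi; have cx w : c * x_ pi w = Y G w by rewrite -cxY.
have /and3P[_ _ p0] := blocksP pi.
have [B0|[i iB]] := finset.set_0Vmem B; first by rewrite -B0 Bpi in p0.
have [B1|] := set_0Vmem (B :\ i).
  by left; rewrite (cardsD1 i) iB B1 cards0.
case=> j; rewrite !inE eq_sym => /andP[ij jB]; right.
have pij : same_block pi i j by rewrite (block_same_block _ Bpi).
have := cx (word [ffun k : 'I_n => val k]); rewrite Y_word_id x_word_discrete; last first.
  by move=> u v _; rewrite !ffunE => /val_inj.
have := cx (word [ffun k : 'I_n => val (if k == j then i else k)]).
rewrite x_word_atom // Y_word rmorphD mulrDr.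
(* Put [a = c * mobius (atom i j) pi]. Then [- a * (#|B| - 1) = 1], and [1 + a] is 1 or 0. The value
   1 gives [a = 0], a contradiction; the value 0 gives [a = -1], whence [#|B| = 2]. *)
move=> + c1; rewrite c1; move: c1; rewrite (mobius_discrete_atom Bpi iB jB ij).
rewrite rmorphN rmorphMn /= mulrN mulrnAr.
case: asboolP => _ => [c1 /eqP|c1 /eqP].
  by rewrite -subr_eq0 addrC addKr => /eqP ca; rewrite ca mul0rn oppr0 in c1.
rewrite addrC addr_eq0 => /eqP ca; move: c1; rewrite ca mulNrn opprK => /eqP.
by rewrite (eqr_nat _ _ 1%N); case: #|B| => // b /eqP /= ->.
Qed.

End SetPartitions.

Theorem theorem5p6 (n : nat) (hn : (0 < n)%N) (pi : setpart n) :
  (forall (c : rat) (m : nat) (G : lgraph m),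
     c *: x_ pi = Y G ->
     (c = 1 \/ c = -1) /\
     (forall B : {set 'I_n}, B \in blocks pi -> #|B| = 1%N \/ #|B| = 2%N)) /\
  ((forall B : {set 'I_n}, B \in blocks pi -> #|B| = 1%N \/ #|B| = 2%N) ->
   x_ pi = (-1) ^+ #|[set B in blocks pi | #|B| == 2%N]| *: Y (K pi)).
Proof.
split=> [c m G cxY|/thinP]; last exact: x_thin.
(* The word with distinct letters has coefficient 1 in [Y G], whereas [x_ pi] vanishes on words of
   length other than [n]. *)
have mn : m = n.
  apply/eqP; apply: contraT => mn.
  have := congr1 (fun F => F (word [ffun k : 'I_m => val k])) cxY.
  rewrite Y_word_id [LHS](_ : _ = c * x_ pi (word [ffun k : 'I_m => val k])) //.
  by rewrite x_size ?mulr0 // size_map size_enum_ord.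
subst m; have small := card_block_of_scaled_Y cxY; split=> //.
(* Now that the blocks are small, the same coefficient shows that [c] times a sign is 1. *)
have := congr1 (fun F => F (word [ffun k : 'I_n => val k])) cxY.
rewrite Y_word_id [LHS](_ : _ = c * x_ pi (word [ffun k : 'I_n => val k])) //.
rewrite x_word_discrete; last by move=> u v _; rewrite !ffunE => /val_inj.
rewrite (mobius_discrete_thin (thinP small)) rmorph_sign -signr_odd.
case: odd; rewrite ?mulr1 => c1; [right|by left].
by rewrite -c1 mulrN1 opprK.
Qed.
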